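(* Let $n_1,n_2,n_3\in\mathbb{N}$. If $\alpha(n_1+n_2)=\alpha(n_1)+\alpha(n_2)$, then there exist $\varepsilon,\varepsilon_1,\varepsilon_2\in\{0,1\}$ with $\varepsilon+\varepsilon_1+\varepsilon_2\le 1$ such that $n_1+n_2-\varepsilon$, $n_1+1+\varepsilon_1$ and $n_2+1+\varepsilon_2$ are all Ramsey numbers. Furthermore, if $n_i\ge 3$ for $i=1,2,3$, then $$\alpha(n_1+n_2+n_3)<\alpha(n_1)+\alpha(n_2)+\alpha(n_3).$$
   Context: $R(3,m)$ is the Ramsey number: the smallest $N$ such that every graph on $N$ vertices contains a triangle or a stable set of size $m$. A ''Ramsey number'' means a number of the form $R(3,m)$ for some $m\in\mathbb{N}$. For $n\in\mathbb{N}$, $\alpha(n)$ is the minimum, over triangle-free graphs $G$ on $n$ vertices, of the maximum size of a stable set of $G$; equivalently, $R(3,\alpha(n))\le n<R(3,\alpha(n)+1)$. *)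

(* Defs.v *)
From HB Require Import structures.
From mathcomp Require Import all_boot zify.

Set Implicit Arguments.
Unset Strict Implicit.
Unset Printing Implicit Defensive.

(* Adjacency is stored as a finite function so that the simple graphs on [T]   *)
(* themselves form a finite type, over which a minimum can be taken.           *)
Record graph (T : finType) := Graph {
  graph_adj : {ffun T * T -> bool};
  graph_axiom : [forall x, ~~ graph_adj (x, x)] &&
                [forall x, forall y, graph_adj (x, y) == graph_adj (y, x)]
}.

HB.instance Definition _ (T : finType) := [isSub for @graph_adj T].
HB.instance Definition _ (T : finType) := [Finite of graph T by <:].

Section GraphNotions.
Variables (T : finType) (G : graph T).

Definition adj : rel T := fun x y => graph_adj G (x, y).

Definition has_triangle : bool :=
  [exists x, exists y, exists z, [&& adj x y, adj y z & adj x z]].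

Definition triangle_free : bool := ~~ has_triangle.

Definition stable (S : {set T}) : bool :=
  [forall x in S, forall y in S, ~~ adj x y].

Definition max_stable : nat := \max_(S : {set T} | stable S) #|S|.

Lemma adj_irrefl x : adj x x = false.
Proof. by apply/negbTE; have /andP[/forallP /(_ x)] := graph_axiom G. Qed.

Lemma adj_sym x y : adj x y = adj y x.
Proof.
by have /andP[_ /forallP /(_ x) /forallP /(_ y) /eqP] := graph_axiom G.
Qed.

Lemma stableP (S : {set T}) :
  reflect {in S &, forall x y, adj x y = false} (stable S).
Proof.
apply: (iffP forall_inP) => [h x y xS yS|h x xS].
  by apply/negbTE; move/forall_inP: (h x xS); apply.
by apply/forall_inP => y yS; rewrite h.
Qed.

Lemma stable_sub (A B : {set T}) : A \subset B -> stable B -> stable A.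
Proof.
by move=> /subsetP sAB /stableP h; apply/stableP => x y /sAB xB /sAB; apply: h.
Qed.

Lemma stable_nbhd (A : {set T}) x :
  triangle_free -> stable [set y in A | adj x y].
Proof.
move=> tf; apply/stableP => y z; rewrite !inE => /andP[_ xy] /andP[_ xz].
apply/negbTE; apply: contra tf => yz.
by apply/existsP; exists x; apply/existsP; exists y; apply/existsP; exists z;
   rewrite xy yz xz.
Qed.

Lemma greedy_stable m k (A : {set T}) : triangle_free -> k * m <= #|A| ->
  exists S : {set T}, [/\ S \subset A, stable S & (#|S| == k) || (#|S| == m)].
Proof.
move=> tf; elim: k A => [|k IH] A hA.
  exists set0; split; rewrite ?sub0set ?cards0 //.
  by apply/stableP => x y; rewrite inE.
case: (posnP m) => [->|m_gt0].
  exists set0; split; rewrite ?sub0set ?cards0 ?eqxx ?orbT //.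
  by apply/stableP => x y; rewrite inE.
have /card_gt0P[x xA] : 0 < #|A| by move: hA; rewrite mulSn; lia.
pose N := [set y in A | adj x y].
have stN : stable N by exact: stable_nbhd.
have sNA : N \subset A by apply/subsetP => y; rewrite inE => /andP[].
case: (leqP m #|N|) => [le_mN|lt_Nm].
  exists [set y in take m (enum N)].
  have sN : [set y in take m (enum N)] \subset N.
    by apply/subsetP => y; rewrite inE => /mem_take; rewrite mem_enum.
  split; [exact: subset_trans sN sNA | exact: stable_sub sN stN |].
  rewrite cardsE (card_uniqP _) ?take_uniq ?enum_uniq //.
  by rewrite size_takel ?eqxx ?orbT // -cardE.
pose B := A :\: (x |: N).
have xN : x \notin N by rewrite inE adj_irrefl andbF.
have hB : k * m <= #|B|.
  have sxNA : x |: N \subset A by rewrite subUset sub1set xA.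
  have := cardsD A (x |: N).
  rewrite (setIidPr sxNA) cardsU1 xN -/B => ->.
  by move: hA; rewrite mulSn; lia.
have [S [sSB stS cS]] := IH B hB.
case/orP: cS => cS; last first.
  by exists S; split; rewrite ?cS ?orbT // (subset_trans sSB) ?subsetDl.
have hS y : y \in S -> y \in A /\ adj x y = false.
  move=> /(subsetP sSB); rewrite !inE => /andP[h yA]; split=> //.
  by apply/negbTE; move: h; rewrite yA negb_or => /andP[].
exists (x |: S); split.
- by rewrite subUset sub1set xA (subset_trans sSB) ?subsetDl.
- apply/stableP => y z; rewrite !inE => /orP[/eqP->|yS] /orP[/eqP->|zS].
  + exact: adj_irrefl.
  + by case: (hS z zS).
  + by rewrite adj_sym; case: (hS y yS).
  + by move/stableP: stS; apply.
rewrite cardsU1 (eqP cS).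
have -> : x \notin S.
  by apply/negP => /(subsetP sSB); rewrite !inE eqxx.
by rewrite add1n eqxx.
Qed.

End GraphNotions.

Definition ramsey3_prop (m N : nat) : bool :=
  [forall G : graph 'I_N,
     has_triangle G || [exists S : {set 'I_N}, stable G S && (#|S| == m)]].

Lemma ramsey3_ex (m : nat) : exists N, ramsey3_prop m N.
Proof.
exists (m * m); apply/forallP => G.
case: (boolP (has_triangle G)) => //= tf.
have [|S [_ stS /orP cS]] := @greedy_stable _ G m m [set: 'I_(m * m)] tf.
  by rewrite cardsT card_ord.
by apply/existsP; exists S; rewrite stS; case: cS.
Qed.

Definition R3 (m : nat) : nat := ex_minn (ramsey3_ex m).

Definition is_ramsey_number (N : nat) : Prop := exists2 m, 0 < m & N = R3 m.

(* The default value [n] of the minimum is harmless: it bounds every           *)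
(* [max_stable G] and is attained by the edgeless graph; see [alphaP].         *)
Definition alpha (n : nat) : nat :=
  \big[minn/n]_(G : graph 'I_n | triangle_free G) max_stable G.

Lemma edgeless_axiom (T : finType) (e := [ffun _ : T * T => false]) :
  [forall x, ~~ e (x, x)] && [forall x, forall y, e (x, y) == e (y, x)].
Proof.
apply/andP; split; apply/forallP => x; first by rewrite ffunE.
by apply/forallP => y; rewrite !ffunE.
Qed.

Definition edgeless (T : finType) : graph T := Graph (edgeless_axiom T).

Lemma edgeless_triangle_free (T : finType) : triangle_free (edgeless T).
Proof.
by apply/existsP => -[x /existsP[y /existsP[z]]]; rewrite /adj /= !ffunE.
Qed.

Lemma max_stable_edgeless (T : finType) : max_stable (edgeless T) = #|T|.
Proof.
apply/eqP; rewrite eqn_leq; apply/andP; split.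
  by apply/bigmax_leqP => S _; exact: max_card.
rewrite -cardsT; apply: (@leq_bigmax_cond _ _ (fun S : {set T} => #|S|)).
by apply/stableP => x y _ _; rewrite /adj /= ffunE.
Qed.

Lemma alphaP (n : nat) :
  (exists2 G : graph 'I_n, triangle_free G & max_stable G = alpha n) /\
  (forall G : graph 'I_n, triangle_free G -> alpha n <= max_stable G).
Proof.
split; last first.
  move=> G tf; rewrite /alpha.
  elim: (index_enum _) (mem_index_enum G) => [//|H r IH].
  rewrite inE big_cons => /orP[/eqP<-|/IH le_r]; first by rewrite tf geq_minl.
  by case: ifP => // _; rewrite geq_min le_r orbT.
rewrite /alpha; elim/big_ind: _ => [|a b [G1 ? <-] [G2 ? <-]|G tf].
- exists (edgeless 'I_n); first exact: edgeless_triangle_free.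
  by rewrite max_stable_edgeless card_ord.
- case: (leqP (max_stable G1) (max_stable G2)) => h.
    by exists G1 => //; lia.
  by exists G2 => //; lia.
- by exists G.
Qed.

(* Main.v *)
(** Let [G1], [G2] be triangle-free graphs on [n1], [n2] vertices without stable
    sets of more than [alpha n1], [alpha n2] vertices.
    Delete a vertex [vi] from each [Gi] and join [N(v1)] completely to [N(v2)]:
    the graph stays triangle-free, and any stable set of it misses one of the
    two [N(vi)], so that its part in [Gi] could be enlarged by [vi].  Hence
    [alpha (n1 + n2 - 2) < alpha n1 + alpha n2].  At [ni = R(3, ai + 1) - 1]
    this reads [R(3, a1 + a2) >= R(3, a1 + 1) + R(3, a2 + 1) - 3], which
    leaves a slack of one in
    [R(3, a1 + a2) <= n1 + n2 <= R(3, a1 + 1) + R(3, a2 + 1) - 2].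
    If [ni >= 3], choose instead non-adjacent [ui], [vi] in [Gi], add a twin
    [wi] of [vi], and join [v1] to [N(u2)], [w1] to [u2], [v2] to [N(u1)], [w2]
    to [u1].  A stable set may gain a vertex over [G1] by containing both [v1]
    and [w1], but then its part in [G2] could be enlarged by [u2], and likewise
    with the indices exchanged.  Hence
    [alpha (n1 + n2 + 2) <= alpha n1 + alpha n2].  The strict inequality for
    three terms combines the two bounds. *)
Require Import Defs.
From mathcomp Require Import all_boot zify.

Set Implicit Arguments.
Unset Strict Implicit.
Unset Printing Implicit Defensive.

Section StableSets.

Variables (T : finType) (G : graph T).
Implicit Types (S : {set T}) (x y z : T).

Lemma triangle_freeP :
  reflect (forall x y z, adj G x y -> adj G y z -> adj G x z = false)
          (triangle_free G).
Proof.
apply: (iffP existsPn) => [tf x y z xy yz | tf x].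
  apply/negP => xz; case/existsP: (tf x); exists y; apply/existsP; exists z.
  by rewrite xy yz xz.
by apply/existsP => -[y /existsP[z /and3P[xy yz]]]; rewrite (tf _ _ _ xy yz).
Qed.

Lemma nonadjacent_pair :
  triangle_free G -> 2 < #|T| -> exists u v, u != v /\ adj G u v = false.
Proof.
move=> /triangle_freeP tf /card_gt2P[x [y [z [_ [xy yz zx]]]]].
case exy: (adj G x y); last by exists x, y.
case eyz: (adj G y z); last by exists y, z.
by exists z, x; rewrite adj_sym (tf _ _ _ exy eyz).
Qed.

Lemma stable1 x : stable G [set x].
Proof. by apply/stableP => y z /set1P-> /set1P->; exact: adj_irrefl. Qed.

Lemma stableU1 S x :
  stable G S -> {in S, forall y, adj G x y = false} -> stable G (x |: S).
Proof.
move=> /stableP stS xS; apply/stableP => y z.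
rewrite !inE => /orP[/eqP->|yS] /orP[/eqP->|zS]; first exact: adj_irrefl.
- exact: xS.
- by rewrite adj_sym xS.
- exact: stS.
Qed.

Lemma leq_max_stable S : stable G S -> #|S| <= max_stable G.
Proof. exact: (@leq_bigmax_cond _ _ (fun S : {set T} => #|S|)). Qed.

Lemma max_stable_attained : exists2 S, stable G S & #|S| = max_stable G.
Proof.
have st0 : stable G set0 by apply/stableP => x y; rewrite inE.
have := eq_bigmax_cond (fun S : {set T} => #|S|).
case/(_ (stable G)) => [|S stS eqS]; last by exists S.
by apply/card_gt0P; exists set0.
Qed.

Lemma ltn_max_stable S x :
  stable G S -> x \notin S -> {in S, forall y, adj G x y = false} ->
  #|S| < max_stable G.
Proof.
by move=> stS xS /(stableU1 stS)/leq_max_stable; rewrite cardsU1 xS.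
Qed.

End StableSets.

Section GraphOfRel.

Variables (T : finType) (e : rel T).
Hypotheses (e_irr : irreflexive e) (e_sym : symmetric e).

Lemma graph_of_rel_axiom (f := [ffun p : T * T => e p.1 p.2]) :
  [forall x, ~~ f (x, x)] && [forall x, forall y, f (x, y) == f (y, x)].
Proof.
apply/andP; split; apply/forallP => x; first by rewrite ffunE e_irr.
by apply/forallP => y; rewrite !ffunE /= e_sym.
Qed.

Definition graph_of_rel : graph T := Graph graph_of_rel_axiom.

Lemma adj_graph_of_rel : adj graph_of_rel =2 e.
Proof. by move=> x y; rewrite /adj ffunE. Qed.

End GraphOfRel.

Section Comap.

Variables (T U : finType) (f : U -> T) (G : graph T).

Definition comap : graph U :=
  @graph_of_rel U (fun x y => adj G (f x) (f y))
    (fun x => adj_irrefl G (f x)) (fun x y => adj_sym G (f x) (f y)).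

Lemma adj_comap x y : adj comap x y = adj G (f x) (f y).
Proof. exact: adj_graph_of_rel. Qed.

Lemma comap_triangle_free : triangle_free G -> triangle_free comap.
Proof.
move=> /triangle_freeP tf; apply/triangle_freeP => x y z; rewrite !adj_comap.
exact: tf.
Qed.

Lemma stable_comap_nbhd x :
  triangle_free G -> stable comap [set y | adj G x (f y)].
Proof.
move=> /triangle_freeP tf; apply/stableP => y z; rewrite !inE adj_comap.
by move=> xy xz; apply: tf xz; rewrite adj_sym.
Qed.

Lemma stable_imset_comap S : stable comap S -> stable G (f @: S).
Proof.
move=> /stableP stS; apply/stableP => _ _ /imsetP[x xS ->] /imsetP[y yS ->].
by rewrite -adj_comap stS.
Qed.

Lemma leq_card_stable_comap (S : {set U}) :
  {in S &, injective f} -> stable comap S -> #|S| <= max_stable G.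
Proof.
by move=> /card_in_imset<- /stable_imset_comap; exact: leq_max_stable.
Qed.

Lemma leq_max_stable_comap : injective f -> max_stable comap <= max_stable G.
Proof.
move=> f_inj; have [S stS <-] := max_stable_attained comap.
by apply: leq_card_stable_comap => // x y _ _ /f_inj.
Qed.

End Comap.

Lemma alpha_leq_max_stable (T : finType) (G : graph T) n :
  triangle_free G -> n <= #|T| -> alpha n <= max_stable G.
Proof.
move=> tf nT; pose f (i : 'I_n) : T := enum_val (widen_ord nT i).
have f_inj : injective f by move=> i j /enum_val_inj/(congr1 val)/= /val_inj.
apply: leq_trans (leq_max_stable_comap G f_inj); apply: (alphaP n).2.
exact: comap_triangle_free.
Qed.

Lemma alpha_attained (T : finType) :
  exists2 G : graph T, triangle_free G & max_stable G = alpha #|T|.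
Proof.
have [[G tf eqG] _] := alphaP #|T|.
have tf_comap := comap_triangle_free enum_rank tf.
exists (comap enum_rank G) => //.
apply/eqP; rewrite eqn_leq alpha_leq_max_stable //.
by rewrite -eqG leq_max_stable_comap //; exact: enum_rank_inj.
Qed.

Lemma homo_alpha : {homo alpha : m n / m <= n}.
Proof.
move=> m n mn; have [[G tf <-] _] := alphaP n.
by apply: alpha_leq_max_stable; rewrite ?card_ord.
Qed.

Lemma alpha_leq n : alpha n <= n.
Proof.
have := alpha_leq_max_stable (edgeless_triangle_free 'I_n).
by rewrite max_stable_edgeless card_ord; apply.
Qed.

Lemma alpha_gt0 n : 0 < n -> 0 < alpha n.
Proof.
case: n => // n _; have [[G _ <-] _] := alphaP n.+1.
by rewrite -(cards1 (ord0 : 'I_n.+1)) leq_max_stable ?stable1.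
Qed.

Lemma ramsey3_propE m N : ramsey3_prop m N = (m <= alpha N).
Proof.
apply/forallP/idP => [ramsey_mN | le_m G].
  have [[G tf <-] _] := alphaP N; have := ramsey_mN G; rewrite (negbTE tf) /=.
  by case/existsP => S /andP[stS /eqP<-]; exact: leq_max_stable.
case: (boolP (has_triangle G)) => //= tf.
have [S stS cS] := max_stable_attained G.
have /card_geqP[s [us ss sS]] : m <= #|S|.
  by rewrite cS (leq_trans le_m) ?alpha_leq_max_stable ?card_ord.
apply/existsP; exists [set x in s].
rewrite cardsE (card_uniqP us) ss eqxx andbT; apply: stable_sub stS.
by apply/subsetP => x; rewrite inE => /sS.
Qed.

Lemma R3_leq m N : (R3 m <= N) = (m <= alpha N).
Proof.
rewrite /R3; case: ex_minnP => r; rewrite ramsey3_propE => mr min_r.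
apply/idP/idP => [rN | mN]; first exact: leq_trans mr (homo_alpha rN).
by apply: min_r; rewrite ramsey3_propE.
Qed.

Lemma ltn_R3 m N : (N < R3 m) = (alpha N < m).
Proof. by rewrite !ltnNge R3_leq. Qed.

Lemma leq_R3 m : m <= R3 m.
Proof. by apply: leq_trans (alpha_leq _); rewrite -R3_leq. Qed.

Lemma card_set_sum (T1 T2 : finType) (S : {set T1 + T2}) :
  #|S| = #|inl @^-1: S| + #|inr @^-1: S|.
Proof. by rewrite -!sum1dep_card -sum1_card big_sumType. Qed.

Section Glue.

Variables (T1 T2 : finType) (G1 : graph T1) (G2 : graph T2).
Variable c : T1 -> T2 -> bool.
Implicit Type S : {set T1 + T2}.

Definition glue_rel : rel (T1 + T2) := fun x y =>
  match x, y with
  | inl x, inl y => adj G1 x y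
  | inl x, inr y => c x y
  | inr x, inl y => c y x
  | inr x, inr y => adj G2 x y
  end.

Lemma glue_rel_irr : irreflexive glue_rel.
Proof. by case=> x; exact: adj_irrefl. Qed.

Lemma glue_rel_sym : symmetric glue_rel.
Proof. by move=> [x|x] [y|y] //=; exact: adj_sym. Qed.

Definition glue : graph (T1 + T2)%type :=
  graph_of_rel glue_rel_irr glue_rel_sym.

Lemma adj_glue : adj glue =2 glue_rel.
Proof. exact: adj_graph_of_rel. Qed.

Lemma glue_triangle_free :
  triangle_free G1 -> triangle_free G2 ->
  (forall x, stable G2 [set y | c x y]) ->
  (forall y, stable G1 [set x | c x y]) -> triangle_free glue.
Proof.
move=> /triangle_freeP tf1 /triangle_freeP tf2 st2 st1.
have nadj2 x y y' : c x y -> c x y' -> adj G2 y y' = false.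
  by move=> xy xy'; apply: (stableP _ _ (st2 x)); rewrite inE.
have nadj1 y x x' : c x y -> c x' y -> adj G1 x x' = false.
  by move=> xy x'y; apply: (stableP _ _ (st1 y)); rewrite inE.
apply/triangle_freeP => x y z; rewrite !adj_glue.
case: x y z => [x|x] [y|y] [z|z] /= xy yz; try exact: tf1 xy yz.
- by apply/negP => xz; rewrite (nadj1 _ _ _ xz yz) in xy.
- exact: nadj1 xy yz.
- by apply/negP => xz; rewrite (nadj2 _ _ _ xy xz) in yz.
- by apply/negP => xz; rewrite (nadj1 _ _ _ xy xz) in yz.
- exact: nadj2 xy yz.
- by apply/negP => xz; rewrite (nadj2 _ _ _ xz yz) in xy.
- exact: tf2 xy yz.
Qed.

Lemma stable_glue S : stable glue S ->
  [/\ stable G1 (inl @^-1: S), stable G2 (inr @^-1: S) &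
      {in inl @^-1: S & inr @^-1: S, forall x y, c x y = false}].
Proof.
by move=> /stableP stS; split; try apply/stableP;
  move=> x y; rewrite !inE => xS yS; rewrite -(stS _ _ xS yS) adj_glue.
Qed.

End Glue.

Lemma ltn_card_stable_comap_Some (T : finType) (G : graph (option T))
    (S : {set T}) :
  stable (comap Some G) S -> {in S, forall x, adj G None (Some x) = false} ->
  #|S| < max_stable G.
Proof.
move=> /stable_imset_comap stS nS; rewrite -(card_imset _ Some_inj).
apply: (ltn_max_stable (x := None) stS); first by apply/imsetP => -[].
by move=> _ /imsetP[x xS ->]; exact: nS.
Qed.

Section NeighbourhoodGlue.

Variables (T1 T2 : finType) (G1 : graph (option T1)) (G2 : graph (option T2)).

(* The vertex deleted from [Gi] is [None]. *)
Definition nbhd_glue : graph (T1 + T2)%type :=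
  glue (comap Some G1) (comap Some G2)
    (fun x y => adj G1 None (Some x) && adj G2 None (Some y)).

Lemma nbhd_glue_triangle_free :
  triangle_free G1 -> triangle_free G2 -> triangle_free nbhd_glue.
Proof.
move=> tf1 tf2; apply: glue_triangle_free => [||x|y];
  try exact: comap_triangle_free.
- apply: stable_sub (stable_comap_nbhd Some None tf2).
  by apply/subsetP => y; rewrite !inE => /andP[].
- apply: stable_sub (stable_comap_nbhd Some None tf1).
  by apply/subsetP => x; rewrite !inE => /andP[].
Qed.

Lemma ltn_max_stable_nbhd_glue :
  max_stable nbhd_glue < max_stable G1 + max_stable G2.
Proof.
have [S stS <-] := max_stable_attained nbhd_glue.
have [st1 st2 nc] := stable_glue stS; rewrite card_set_sum.
have le1 := leq_trans (leq_max_stable st1) (leq_max_stable_comap G1 Some_inj).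
have le2 := leq_trans (leq_max_stable st2) (leq_max_stable_comap G2 Some_inj).
have [/exists_inP[x xS adj_x] | nS] :=
  boolP [exists x in inl @^-1: S, adj G1 None (Some x)].
- rewrite -addnS leq_add //; apply: (ltn_card_stable_comap_Some st2) => y yS.
  by have := nc _ _ xS yS; rewrite adj_x.
- rewrite -addSn leq_add //; apply: (ltn_card_stable_comap_Some st1) => x xS.
  by apply/negbTE/(exists_inPn nS).
Qed.

End NeighbourhoodGlue.

Lemma ltn_alphaD_pred2 m n :
  0 < m -> 0 < n -> alpha (m + n).-2 < alpha m + alpha n.
Proof.
case: m n => [//|m] [//|n] _ _; rewrite addSn addnS /=.
have [G1 tf1] := alpha_attained (option 'I_m).
have [G2 tf2] := alpha_attained (option 'I_n).
rewrite !card_option !card_ord => <- <-.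
apply: leq_ltn_trans (ltn_max_stable_nbhd_glue G1 G2).
apply: alpha_leq_max_stable; first exact: nbhd_glue_triangle_free.
by rewrite card_sum !card_ord.
Qed.

Lemma leq_R3D a b : 0 < a -> 0 < b -> R3 a.+1 + R3 b.+1 <= R3 (a + b) + 3.
Proof.
move=> a_gt0 b_gt0; have ra := leq_R3 a.+1; have rb := leq_R3 b.+1.
have [pa_gt0 pb_gt0] : 0 < (R3 a.+1).-1 /\ 0 < (R3 b.+1).-1 by split; lia.
have alpha_pred k : 0 < (R3 k.+1).-1 -> alpha (R3 k.+1).-1 <= k.
  by move=> r_gt0; rewrite -ltnS -ltn_R3; lia.
have : ((R3 a.+1).-1 + (R3 b.+1).-1).-2 < R3 (a + b).
  rewrite ltn_R3; apply: leq_trans (ltn_alphaD_pred2 pa_gt0 pb_gt0) _.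
  by rewrite leq_add ?alpha_pred.
lia.
Qed.

Section Twin.

Variables (T : finType) (G : graph T) (v : T).
Implicit Type S : {set option T}.

(* The twin of [v] is [None]. *)
Definition twin : graph (option T) := comap (odflt v) G.

Definition twins : {set option T} := [set None; Some v].

Lemma leq_card_stable_twin S :
  stable twin S -> #|S| <= max_stable G + (twins \subset S).
Proof.
have card_no_twins A : stable twin A -> ~~ (twins \subset A) ->
    #|A| <= max_stable G.
  move=> stA; rewrite subUset !sub1set => nA; apply: leq_card_stable_comap stA.
  move=> [x|] [y|] //= xA yA; first by move=> ->.
  - by move=> xv; rewrite -xv xA yA in nA.
  - by move=> vy; rewrite vy xA yA in nA.
move=> stS; have [|nS] := boolP (_ \subset _); last first.
  by rewrite addn0 card_no_twins.
rewrite subUset !sub1set => /andP[NS _].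
rewrite (cardsD1 None) NS addnC leq_add2r.
apply: card_no_twins; first by apply: stable_sub stS; exact: subsetDl.
by rewrite subUset !sub1set !inE.
Qed.

Lemma ltn_card_stable_twin S u :
  u != v -> stable twin S -> Some u \notin S ->
  {in S, forall x, adj twin (Some u) x = false} ->
  #|S| < max_stable G + (twins \subset S).
Proof.
move=> uv stS uS nadj; have := leq_card_stable_twin (stableU1 stS nadj).
rewrite cardsU1 uS add1n !subUset !sub1set !inE /=.
by rewrite (inj_eq Some_inj) eq_sym (negbTE uv).
Qed.

End Twin.

(* [adj G2 u2 (odflt v2 y)] is the adjacency of [Some u2] and [y] in
   [twin G2 v2]. *)
Definition twin_link (T1 T2 : finType) (v1 : T1) (G2 : graph T2) (u2 v2 : T2)
    (x : option T1) (y : option T2) : bool :=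
  if x is Some x' then (x' == v1) && adj G2 u2 (odflt v2 y)
  else y == Some u2.

Definition twin_cross (T1 T2 : finType) (G1 : graph T1) (u1 v1 : T1)
    (G2 : graph T2) (u2 v2 : T2) (x : option T1) (y : option T2) : bool :=
  twin_link v1 G2 u2 v2 x y || twin_link v2 G1 u1 v1 y x.

Lemma twin_crossC (T1 T2 : finType) (G1 : graph T1) u1 v1
    (G2 : graph T2) u2 v2 x y :
  twin_cross G1 u1 v1 G2 u2 v2 x y = twin_cross G2 u2 v2 G1 u1 v1 y x.
Proof. exact: orbC. Qed.

Lemma stable_twin_cross (T1 T2 : finType) (G1 : graph T1) u1 v1
    (G2 : graph T2) u2 v2 x :
  u1 != v1 -> adj G1 u1 v1 = false -> triangle_free G2 ->
  stable (twin G2 v2) [set y | twin_cross G1 u1 v1 G2 u2 v2 x y].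
Proof.
move=> uv nuv tf2; have neq_v1u1 : (Some v1 == Some u1) = false.
  by rewrite (inj_eq Some_inj) eq_sym (negbTE uv).
have singleton y0 : (forall y, twin_cross G1 u1 v1 G2 u2 v2 x y -> y = y0) ->
    stable (twin G2 v2) [set y | twin_cross G1 u1 v1 G2 u2 v2 x y].
  move=> y0P; apply: stable_sub (stable1 _ y0).
  by apply/subsetP => y; rewrite !inE => /y0P->.
case: x singleton => [x|] singleton; last first.
  apply: (singleton (Some u2)) => y; rewrite /twin_cross /= => /orP[/eqP//|].
  by case: y => [y|] //=; rewrite nuv andbF.
have [->|xv] := eqVneq x v1.
  apply: stable_sub (stable_comap_nbhd (odflt v2) u2 tf2).
  apply/subsetP => y; rewrite !inE /twin_cross /= eqxx /= => /orP[//|].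
  by case: y => [y|] /=; rewrite ?nuv ?andbF ?neq_v1u1.
have [xu|xu] := eqVneq x u1.
  apply: (singleton None) => -[y|] //; rewrite /twin_cross /= (negbTE xv) xu /=.
  by rewrite adj_irrefl andbF.
apply: (singleton (Some v2)) => -[y|]; rewrite /twin_cross /= (negbTE xv) /=.
  by case/andP=> /eqP->.
by rewrite (inj_eq Some_inj) (negbTE xu).
Qed.

Lemma ltn_card_twin_link (T1 T2 : finType) v1 (G2 : graph T2) u2 v2
    (A : {set option T1}) (B : {set option T2}) :
  u2 != v2 -> {in A & B, forall x y, twin_link v1 G2 u2 v2 x y = false} ->
  stable (twin G2 v2) B -> twins v1 \subset A ->
  #|B| < max_stable G2 + (twins v2 \subset B).
Proof.
move=> uv nlink stB; rewrite subUset !sub1set => /andP[NA vA].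
apply: (ltn_card_stable_twin uv stB) => [|y yB].
  by apply/negP => uB; have := nlink _ _ NA uB; rewrite /= eqxx.
by have := nlink _ _ vA yB; rewrite /= eqxx adj_comap.
Qed.

Section TwinGlue.

Variables (T1 T2 : finType) (G1 : graph T1) (u1 v1 : T1).
Variables (G2 : graph T2) (u2 v2 : T2).
Hypotheses (uv1 : u1 != v1) (uv2 : u2 != v2).

Definition twin_glue : graph (option T1 + option T2)%type :=
  glue (twin G1 v1) (twin G2 v2) (twin_cross G1 u1 v1 G2 u2 v2).

Lemma twin_glue_triangle_free :
  adj G1 u1 v1 = false -> adj G2 u2 v2 = false ->
  triangle_free G1 -> triangle_free G2 -> triangle_free twin_glue.
Proof.
move=> nuv1 nuv2 tf1 tf2; apply: glue_triangle_free => [||x|y];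
  try exact: comap_triangle_free.
- exact: stable_twin_cross.
- apply: stable_sub (stable_twin_cross u1 v1 y uv2 nuv2 tf1).
  by apply/subsetP => x; rewrite !inE twin_crossC.
Qed.

Lemma leq_max_stable_twin_glue :
  max_stable twin_glue <= max_stable G1 + max_stable G2.
Proof.
have [S stS <-] := max_stable_attained twin_glue.
have [st1 st2 ncross] := stable_glue stS; rewrite card_set_sum.
set A := inl @^-1: S in st1 ncross *; set B := inr @^-1: S in st2 ncross *.
have leA := leq_card_stable_twin st1; have leB := leq_card_stable_twin st2.
have ltB : twins v1 \subset A -> #|B| < max_stable G2 + (twins v2 \subset B).
  apply: (ltn_card_twin_link uv2 _ st2) => x y xA yB.
  by have /norP[/negbTE] := negbT (ncross _ _ xA yB).
have ltA : twins v2 \subset B -> #|A| < max_stable G1 + (twins v1 \subset A).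
  apply: (ltn_card_twin_link uv1 _ st1) => y x yB xA.
  by have /norP[_ /negbTE] := negbT (ncross _ _ xA yB).
move: #|A| #|B| leA leB ltA ltB => a b.
by case: (twins v1 \subset A); case: (twins v2 \subset B) => /=; lia.
Qed.

End TwinGlue.

Lemma leq_alphaD_succ2 m n :
  2 < m -> 2 < n -> alpha (m + n).+2 <= alpha m + alpha n.
Proof.
move=> m_gt2 n_gt2.
have [[G1 tf1 <-] _] := alphaP m; have [[G2 tf2 <-] _] := alphaP n.
have [|u1 [v1 [uv1 nuv1]]] := nonadjacent_pair tf1; first by rewrite card_ord.
have [|u2 [v2 [uv2 nuv2]]] := nonadjacent_pair tf2; first by rewrite card_ord.
apply: leq_trans (leq_max_stable_twin_glue G1 G2 uv1 uv2).
apply: alpha_leq_max_stable; first exact: twin_glue_triangle_free.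
by rewrite card_sum !card_option !card_ord addSn addnS.
Qed.

Theorem theorem3p19 (n1 n2 n3 : nat)
    (n1_gt0 : 0 < n1) (n2_gt0 : 0 < n2) (n3_gt0 : 0 < n3) :
  (alpha (n1 + n2) = alpha n1 + alpha n2 ->
     exists e e1 e2 : nat,
       [/\ e <= 1, e1 <= 1 & e2 <= 1] /\
       e + e1 + e2 <= 1 /\
       [/\ is_ramsey_number (n1 + n2 - e),
           is_ramsey_number (n1 + 1 + e1)
         & is_ramsey_number (n2 + 1 + e2)])
  /\
  (3 <= n1 -> 3 <= n2 -> 3 <= n3 ->
     alpha (n1 + n2 + n3) < alpha n1 + alpha n2 + alpha n3).
Proof.
split=> [alphaD | n1_ge3 n2_ge3 n3_ge3].
- have a1_gt0 := alpha_gt0 n1_gt0; have a2_gt0 := alpha_gt0 n2_gt0.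
  have r12_le : R3 (alpha n1 + alpha n2) <= n1 + n2 by rewrite R3_leq alphaD.
  have r1_gt : n1 < R3 (alpha n1).+1 by rewrite ltn_R3.
  have r2_gt : n2 < R3 (alpha n2).+1 by rewrite ltn_R3.
  have rD := leq_R3D a1_gt0 a2_gt0.
  exists (n1 + n2 - R3 (alpha n1 + alpha n2)).
  exists (R3 (alpha n1).+1 - n1.+1), (R3 (alpha n2).+1 - n2.+1).
  split; [by split; lia | split; first by lia].
  split; [exists (alpha n1 + alpha n2) | exists (alpha n1).+1
         | exists (alpha n2).+1]; lia.
- apply: leq_trans (ltn_alphaD_pred2 (m := (n1 + n2).+2) _ n3_gt0) _ => //.
  by rewrite leq_add2r leq_alphaD_succ2.
Qed.
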